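(* (i) For any function $l=l(s)$ taking nonnegative integer values with $l(s)\leq\frac{\ln s}{6\ln 3}$, one has $\mathrm{SCN}(2s+1,(s+1)^2+l)=s+2$ for all sufficiently large $s$. (ii) For any such function $l=l(s)\leq \frac{\ln s}{6\ln 3}$, one has $\mathrm{SCN}(2s,s(s+1)+l)=s+2$ for all sufficiently large $s$.
   Context: Let $v,N,t$ be positive integers and $[v]=\{1,\dots,v\}$. An $N\times v$ array $C$ whose rows are permutations of $[v]$ is an $(N,v,t)$-suitable core if the following holds: choose $N$ new distinct symbols, prepend a different one of them to each row of $C$, and append the remaining $N-1$ new symbols (in arbitrary order) to that row; the resulting $N\times(v+N)$ array has the property that for every $t$-element subset $S$ of the $v+N$ symbols and every $\sigma\in S$ there is a row in which $\sigma$ occurs before every element of $S\setminus\{\sigma\}$. (Equivalently: for every symbol $\sigma\in[v]$ and every subset $T\subseteq[v]\setminus\{\sigma\}$, the number of rows of $C$ in which $\sigma$ precedes every element of $[v]\setminus(T\cup\{\sigma\})$ is at least $t+1-v+|T|$.) For positive integers $t,N$, $\mathrm{SCN}(t,N)$ denotes the largest $v$ for which an $(N,v,t)$-suitable core exists. *)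

(* Defs.v *)
From mathcomp Require Import all_boot all_order all_fingroup.

Set Implicit Arguments.
Unset Strict Implicit.
Unset Printing Implicit Defensive.

Definition suitable (W : finType) (N t : nat) (A : 'I_N -> seq W) : Prop :=
  forall (S : {set W}) (x : W), #|S| = t -> x \in S ->
    exists i : 'I_N, forall y : W, y \in S :\ x ->
      index x (A i) < index y (A i).

(* C i j is the entry of C in row i and column j. The old symbols are
   inl k, the new ones inr k. The new symbol prepended to row i is p i, and
   r i lists the other new symbols, in the order in which they are appended. *)
Definition extension (N v : nat) (C : 'I_N -> {perm 'I_v})
    (p : {perm 'I_N}) (r : 'I_N -> seq 'I_N) (i : 'I_N) : seq ('I_v + 'I_N) :=
  inr (p i) :: [seq inl (C i j) | j <- enum 'I_v] ++ [seq inr k | k <- r i].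

Definition suitable_core (N v t : nat) (C : 'I_N -> {perm 'I_v}) : Prop :=
  forall (p : {perm 'I_N}) (r : 'I_N -> seq 'I_N),
    (forall i, perm_eq (p i :: r i) (enum 'I_N)) ->
    suitable t (extension C p r).

Definition has_suitable_core (N v t : nat) : Prop :=
  exists C : 'I_N -> {perm 'I_v}, suitable_core t C.

(* SCN(t, N) = v *)
Definition is_SCN (t N v : nat) : Prop :=
  [/\ 0 < v, has_suitable_core N v t
    & forall v' : nat, 0 < v' -> has_suitable_core N v' t -> v' <= v].

(* Main.v *)
Require Import Defs.
From mathcomp Require Import all_boot all_order all_algebra all_fingroup.
From mathcomp Require Import reals exp.
From mathcomp Require Import zify.

(* A core amounts to a family of rankings of the [v] old symbols in which every
   symbol [x] precedes all of [U] in at least [t - #|U|] rows, for every set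
   [U] of other old symbols.

   For [v = s + 2], take one row per pair [(a, b)] with [a != b] and [b]
   outside [Z], starting with [a], [b], and then [Z], where [Z] has one element
   if [t] is odd and two if [t] is even.

   For [v = s + 3], put [m = t + 1 - v]. Every symbol leads at least [m] rows
   and there are only [m v + e] rows with [e = l + O(1)], so all but at most [e]
   "heavy" symbols are "light": they lead exactly [m]. If [a], [b] are light,
   some row starts with [a], [b]; choose one. This leaves so few "spare" rows
   led by [a] that at least three heavy symbols are not the first heavy symbol
   of any of them, and by the pigeonhole principle many light [a] have the same
   set of first heavy symbols in their spare rows. For a pair [{a, b}] of these,
   one of the three is not the first heavy symbol in the rows chosen for
   [(a, b)] and [(b, a)]; colour the pair with it. A set [T], monochromatic in
   colour [c] and larger than the excess of [c], then contradicts the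
   characterisation for [c] and the complement of [c |: T]. Ramsey's theorem
   yields [T] as soon as [s] is exponentially large in [e]. *)

Set Implicit Arguments.
Unset Strict Implicit.
Unset Printing Implicit Defensive.

Import GRing.Theory Num.Theory.

Lemma exists_subset_card (T : finType) (A : {set T}) k :
  k <= #|A| -> exists2 B : {set T}, B \subset A & #|B| = k.
Proof.
case/card_geqP=> s [uniq_s <- sA]; exists [set:: s].
  by apply/subsetP => x; rewrite inE; apply: sA.
by rewrite cardsE; apply/card_uniqP.
Qed.

Lemma exists_superset_card (T : finType) (A : {set T}) k :
  #|A| <= k -> k <= #|T| -> exists2 B : {set T}, A \subset B & #|B| = k.
Proof.
move=> leA lek; have [|B sB cB] := @exists_subset_card T (~: A) (#|T| - k).
  by rewrite cardsCs setCK leq_sub2l.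
exists (~: B); first by rewrite subsetC.
by rewrite cardsCs setCK cB subKn.
Qed.

Lemma ltn_card_subsetPn (T : finType) (A B : {set T}) :
  #|B| < #|A| -> exists2 x, x \in A & x \notin B.
Proof.
move=> ltBA; apply/subsetPn; apply: contraL ltBA => /subset_leq_card.
by rewrite -leqNgt.
Qed.

Lemma set2_of_mem (T : finType) (z0 z1 x y : T) :
    x \in [set z0; z1] -> y \in [set z0; z1] -> x != y ->
  [set z0; z1] = [set x; y].
Proof.
move=> xZ yZ xy; apply/esym/eqP; rewrite eqEcard subUset !sub1set xZ yZ /=.
by rewrite !cards2 xy; case: (_ != _).
Qed.

Lemma card_set_sum (T U : finType) (S : {set T + U}) :
  #|S| = #|[set x | inl x \in S]| + #|[set y | inr y \in S]|.
Proof.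
rewrite -!sum1_card big_sumType /=.
by congr (_ + _); apply: eq_bigl => x; rewrite inE.
Qed.

Lemma leq_card_bigcup (T K : finType) (D : {set K}) (F : K -> {set T}) :
  #|\bigcup_(j in D) F j| <= \sum_(j in D) #|F j|.
Proof.
elim/big_rec2: _ => [|j s S _ leSs]; first by rewrite cards0.
by apply: leq_trans (leq_card_setU _ _) _; rewrite leq_add2l.
Qed.

Lemma pigeonhole_bigcup (T K : finType) (A : {set T}) (D : {set K})
    (F : K -> {set T}) n :
    A \subset \bigcup_(j in D) F j -> #|D| * n < #|A| ->
  exists2 j, j \in D & n < #|F j|.
Proof.
move=> sAF ltn; apply/exists_inP; apply: contraLR ltn => /exists_inPn small.
rewrite -leqNgt; apply: leq_trans (subset_leq_card sAF) _.
apply: leq_trans (leq_card_bigcup _ _) _; rewrite -sum_nat_const.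
by apply: leq_sum => j jD; rewrite leqNgt small.
Qed.

Definition clique (V : finType) (e : rel V) (T : {set V}) : Prop :=
  {in T &, forall x y, x != y -> e x y}.

Lemma clique0 (V : finType) (e : rel V) : clique e set0.
Proof. by move=> x y; rewrite inE. Qed.

Lemma cliqueU1 (V : finType) (e : rel V) x (T : {set V}) :
  symmetric e -> {in T, forall y, e x y} -> clique e T -> clique e (x |: T).
Proof.
move=> e_sym xT cT y z /setU1P[->|yT] /setU1P[->|zT]; rewrite ?eqxx // => nyz.
- exact: xT.
- by rewrite e_sym; apply: xT.
- exact: cT.
Qed.

Lemma sum_subn_delta (K : finType) (D : {set K}) (k : K -> nat) j :
    j \in D -> 0 < k j ->
  \sum_(i in D) (k i - (i == j)) = (\sum_(i in D) k i).-1.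
Proof.
move=> jD kj; rewrite !(bigD1 j jD) /= eqxx.
rewrite (eq_bigr k) => [|i /andP[_ /negPf->]]; last by rewrite subn0.
by rewrite -(prednK kj) addSn subn1.
Qed.

Lemma multicolor_ramsey (V K : finType) (e : K -> rel V) (D : {set K})
    (k : K -> nat) (A : {set V}) :
    (forall j, symmetric (e j)) -> 1 < #|D| ->
    clique (fun x y => [exists j in D, e j x y]) A ->
    #|D| ^ (\sum_(j in D) k j) <= #|A| ->
  exists j, exists T : {set V},
    [/\ j \in D, T \subset A, #|T| = k j & clique (e j) T].
Proof.
move=> e_sym D1; move def_n: (\sum_(j in D) k j) => n.
elim: n k A def_n => [|n IHn] k A def_n cover leA.
  have /card_gt0P[j jD] := ltnW D1; exists j, set0.
  split; rewrite ?sub0set ?cards0 //; last exact: clique0.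
  by apply/esym/eqP; move/eqP: def_n; rewrite sum_nat_eq0 => /forall_inP->.
have [/exists_inP[j jD /eqP kj]|/exists_inPn k_gt0] :=
    boolP [exists j in D, k j == 0].
  by exists j, set0; split; rewrite ?sub0set ?cards0 //; apply: clique0.
have /card_gt0P[x xA] : 0 < #|A|.
  by apply: leq_trans leA; rewrite expn_gt0 ltnW.
have [||j jD ltn] := @pigeonhole_bigcup _ _ (A :\ x) D
    (fun j => [set y in A :\ x | e j x y]) (#|D| ^ n).-1.
- apply/subsetP => y yAx; have [yx yA] := setD1P yAx; rewrite eq_sym in yx.
  have /exists_inP[j jD exy] := cover x y xA yA yx.
  by apply/bigcupP; exists j; rewrite // inE yAx.
- have : 0 < #|D| ^ n by rewrite expn_gt0 ltnW.
  by move: leA; rewrite (cardsD1 x A) xA expnS; nia.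
have kj : 0 < k j by rewrite lt0n k_gt0.
have [|y z||i [T [iD sT cT eT]]] :=
    IHn (fun i => k i - (i == j)) [set y in A :\ x | e j x y].
- by rewrite sum_subn_delta // def_n.
- rewrite !inE => /andP[/andP[_ yA] _] /andP[/andP[_ zA] _].
  exact: cover.
- exact: leq_trans (leqSpred _) ltn.
have sTA : T \subset A.
  apply: subset_trans sT _; apply/subsetP => y.
  by rewrite !inE => /andP[/andP[]].
have [eq_ij|nij] := eqVneq i j; last first.
  by exists i, T; rewrite cT (negPf nij) subn0.
have xT : x \notin T by apply/negP => /(subsetP sT); rewrite !inE eqxx.
exists j, (x |: T); split=> //; first by rewrite subUset sub1set xA.
  by rewrite cardsU1 xT cT eq_ij eqxx subn1 add1n prednK.
apply: cliqueU1 => [|y|] //; last by rewrite -eq_ij.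
by move/(subsetP sT); rewrite inE => /andP[].
Qed.

(* [rk i x] is the position of the symbol [x] in row [i]; only the order of the
   positions matters. *)
Definition rows_before (I V : finType) (rk : I -> V -> nat) (x : V)
    (U : {set V}) : {set I} :=
  [set i | [forall y in U, rk i x < rk i y]].

Lemma rows_beforeP (I V : finType) (rk : I -> V -> nat) x (U : {set V}) i :
  reflect {in U, forall y, rk i x < rk i y} (i \in rows_before rk x U).
Proof. by rewrite inE; apply: forall_inP. Qed.

Definition suitable_ranking (I V : finType) (t : nat)
    (rk : I -> V -> nat) : Prop :=
  forall x (U : {set V}), x \notin U -> t <= #|U| + #|rows_before rk x U|.

Lemma suitable_ranking_restrict (I V W : finType) t (rk : I -> V -> nat)
    (f : W -> V) :
  injective f -> suitable_ranking t rk ->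
  suitable_ranking t (fun i x => rk i (f x)).
Proof.
move=> f_inj rkP x U xU; have := rkP (f x) (f @: U).
rewrite mem_imset // xU card_imset // => /(_ isT)/leq_trans; apply.
rewrite leq_add2l; apply/subset_leq_card/subsetP => i /rows_beforeP lt_x.
by apply/rows_beforeP => y yU; apply/lt_x/imset_f.
Qed.

Lemma suitable_ranking_homo (I J V : finType) t (rk : I -> V -> nat)
    (rk' : J -> V -> nat) (f : I -> J) :
    injective f ->
    (forall i x y, rk i x < rk i y -> rk' (f i) x < rk' (f i) y) ->
  suitable_ranking t rk -> suitable_ranking t rk'.
Proof.
move=> f_inj f_homo rkP x U xU; apply: leq_trans (rkP x U xU) _.
rewrite leq_add2l -(card_imset _ f_inj).
apply/subset_leq_card/subsetP => _ /imsetP[i /rows_beforeP lt_x ->].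
by apply/rows_beforeP => y yU; apply/f_homo/lt_x.
Qed.

Definition core_rank (N v : nat) (C : 'I_N -> {perm 'I_v}) (i : 'I_N)
  (x : 'I_v) : nat := ((C i)^-1)%g x.

Section Extension.

Variables (N v : nat) (C : 'I_N -> {perm 'I_v}).
Variables (p : {perm 'I_N}) (r : 'I_N -> seq 'I_N).

Lemma index_extension_old i x :
  index (inl x) (extension C p r i) = (core_rank C i x).+1.
Proof.
have inl_inj : injective (fun j => inl (C i j) : 'I_v + 'I_N).
  by move=> a b [] /perm_inj.
rewrite /extension /= -[in LHS](permKV (C i) x) index_cat.
by rewrite mem_map ?mem_enum //= index_map // index_enum_ord.
Qed.

Lemma index_extension_head i :
  index (inr (p i)) (extension C p r i) = 0.
Proof. by rewrite /= eqxx. Qed.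

Lemma index_extension_tail i k :
  k != p i -> v < index (inr k) (extension C p r i).
Proof.
move=> kp; rewrite /extension /= ifF; last first.
  by apply/negbTE; apply: contra_neq kp => -[].
rewrite index_cat ifF; first by rewrite size_map size_enum_ord ltnS leq_addr.
by apply/negP => /mapP[].
Qed.

Lemma extension_head_first i z :
  z != inr (p i) ->
  index (inr (p i)) (extension C p r i) < index z (extension C p r i).
Proof.
rewrite index_extension_head; case: z => [x|k] ne.
  by rewrite index_extension_old.
apply: leq_ltn_trans (leq0n _) (index_extension_tail _).
by apply: contra_neq ne => ->.
Qed.

Lemma extension_old_firstP i (S : {set 'I_v + 'I_N}) x :
  (forall z, z \in S :\ inl x ->
     index (inl x) (extension C p r i) < index z (extension C p r i)) <->
  (i \in rows_before (core_rank C) x ([set y | inl y \in S] :\ x)) &&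
  (inr (p i) \notin S).
Proof.
split=> [first_x | /andP[/rows_beforeP first_x pS] [y|k] /setD1P[ne zS]].
- apply/andP; split.
    apply/rows_beforeP => y; rewrite !inE => /andP[yx yS].
    have := first_x (inl y); rewrite !index_extension_old ltnS; apply.
    by rewrite !inE yS andbT; apply: contra_neq yx => -[].
  apply/negP => pS; have := first_x (inr (p i)).
  by rewrite index_extension_head !inE pS => /(_ isT).
- rewrite !index_extension_old ltnS first_x // !inE zS andbT.
  by apply: contra_neq ne => ->.
- rewrite index_extension_old.
  apply: leq_ltn_trans (ltn_ord _) (index_extension_tail _).
  by apply: contraNneq pS => <-.
Qed.

End Extension.

Lemma suitable_coreP N v t (C : 'I_N -> {perm 'I_v}) :
  t <= N.+1 -> suitable_core t C <-> suitable_ranking t (core_rank C).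
Proof.
move=> leN; split=> [coreC x U xU | rkP p r _ S [x|k] cS xS].
- rewrite leqNgt; apply/negP => few.
  have [||W sW cW] := @exists_superset_card _
      (rows_before (core_rank C) x U) (t - #|U|.+1).
  + by move: few; lia.
  + by rewrite card_ord; lia.
  pose S : {set 'I_v + 'I_N} := [set z | match z with
    | inl y => y \in x |: U | inr k => k \in W end].
  have old_S : [set y | inl y \in S] = x |: U.
    by apply/setP => y; rewrite inE [_ \in S]inE.
  have new_S : [set k | inr k \in S] = W.
    by apply/setP => k; rewrite !inE.
  have [|||i /extension_old_firstP] :=
      coreC 1%g (fun i => rem i (enum 'I_N)) _ S (inl x).
  + by move=> i; rewrite perm1 perm_sym perm_to_rem ?mem_enum.
  + rewrite card_set_sum old_S new_S cardsU1 xU cW.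
    by move: few; lia.
  + by rewrite inE setU11.
  rewrite old_S setU1K // perm1 => /andP[iR]; rewrite inE.
  by rewrite (subsetP sW).
- pose U := [set y | inl y \in S] :\ x.
  have [|i iR iS] := @ltn_card_subsetPn _ (rows_before (core_rank C) x U)
      (p @^-1: [set k | inr k \in S]).
    have xU : x \notin U by rewrite !inE eqxx.
    have := rkP x U xU; rewrite card_preimset; last exact: perm_inj.
    rewrite -cS card_set_sum (cardsD1 x [set y | inl y \in S]) inE xS -/U.
    by rewrite addnAC addnC leq_add2l.
  by exists i; apply/extension_old_firstP; rewrite iR /=; rewrite !inE in iS.
- exists ((p^-1)%g k) => z /setD1P[zk _]; rewrite -{1}(permKV p k).
  by apply: extension_head_first; rewrite permKV.
Qed.

Lemma perm_of_weights v (w : 'I_v -> nat) :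
  exists q : {perm 'I_v}, forall x y, w x < w y -> (q^-1)%g x < (q^-1)%g y.
Proof.
pose s := sort (relpre w leq) (enum 'I_v).
have mem_s x : x \in s by rewrite mem_sort mem_enum.
have index_s x : index x s < v.
  by rewrite -[ltnRHS]size_enum_ord -(size_sort (relpre w leq)) index_mem.
pose rank x := Ordinal (index_s x).
have rank_inj : injective rank.
  by move=> x y /(congr1 val); apply: (index_inj x).
exists (perm rank_inj)^-1%g => x y; rewrite invgK !permE !ltnNge /=.
apply: contra; apply: (@sorted_leq_index _ (relpre w leq) _ _ s).
- by move=> a b c; apply: leq_trans.
- by move=> a; apply: leqnn.
- by apply: sort_sorted => a b; apply: leq_total.
- exact: mem_s.
- exact: mem_s.
Qed.

Lemma has_suitable_core_of_ranking (I : finType) N v t (rk : I -> 'I_v -> nat) :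
  t <= N.+1 -> #|I| <= N -> suitable_ranking t rk -> has_suitable_core N v t.
Proof.
move=> leN leI rkP; pose row (i : I) : 'I_N := widen_ord leI (enum_rank i).
have row_inj : injective row.
  by move=> a b /(congr1 val) /= /val_inj/enum_rank_inj.
have [j|C CP] := @fin_all_exists 'I_N _ (fun j (q : {perm 'I_v}) =>
    forall i, row i = j ->
      forall x y, rk i x < rk i y -> (q^-1)%g x < (q^-1)%g y).
  have [i /eqP<-|no_row] := pickP (fun i => row i == j).
    by have [q qP] := perm_of_weights (rk i); exists q => i' /row_inj->.
  by exists 1%g => i /eqP; rewrite no_row.
exists C; apply/suitable_coreP => //.
apply: (suitable_ranking_homo row_inj) rkP => i; exact: (CP (row i) i erefl).
Qed.

Lemma has_suitable_core_restrict N v t w :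
    t <= N.+1 -> w <= v -> has_suitable_core N v t ->
  exists rk : 'I_N -> 'I_w -> nat, suitable_ranking t rk.
Proof.
move=> leN lewv [C /(suitable_coreP _ leN) rkP].
exists (fun i x => core_rank C i (widen_ord lewv x)).
apply: suitable_ranking_restrict rkP => x y /(congr1 val) /=; exact: val_inj.
Qed.

Lemma suitable_ranking_compl (I V : finType) (rk : I -> V -> nat) t m x
    (T : {set V}) :
    suitable_ranking t rk -> m + #|V| = t.+1 -> x \notin T ->
  m + #|T| <= #|rows_before rk x (~: (x |: T))|.
Proof.
move=> rkP mV xT; have := rkP x (~: (x |: T)); rewrite !inE eqxx => /(_ isT).
by have := cardsC (x |: T); rewrite cardsU1 xT; lia.
Qed.

Section HeavySymbols.

Variables (I V : finType) (rk : I -> V -> nat) (t m : nat) (x0 : V) (i0 : I).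

Definition first_in (A : {set V}) (i : I) : V :=
  odflt x0 [pick x in A | [forall y in A, rk i x <= rk i y]].

Lemma first_inP (A : {set V}) i : 0 < #|A| ->
  first_in A i \in A /\ {in A, forall y, rk i (first_in A i) <= rk i y}.
Proof.
case/card_gt0P=> a aA; rewrite /first_in.
case: pickP => [x /andP[xA /forall_inP] //|no_min].
case: (arg_minnP (rk i) aA) => x xA x_min; case/negP: (negbT (no_min x)).
by rewrite [x \in A]xA; apply/forall_inP.
Qed.

Lemma first_in_eq (A : {set V}) i x :
  x \in A -> {in A, forall y, y != x -> rk i x < rk i y} -> first_in A i = x.
Proof.
move=> xA lt_x; have [|fA le_f] := @first_inP A i.
  by apply/card_gt0P; exists x.
by apply: contraTeq (le_f x xA) => fx; rewrite -ltnNge lt_x.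
Qed.

Definition leader (i : I) : V := first_in [set: V] i.

Definition led_rows (x : V) : {set I} := [set i | leader i == x].

Definition excess (x : V) : nat := #|led_rows x| - m.

Definition heavy : {set V} := [set x | 0 < excess x].

Definition light : {set V} := ~: heavy.

Lemma leader_rows_before x (T : {set V}) i :
  i \in rows_before rk x (~: (x |: T)) -> i \notin led_rows x -> leader i \in T.
Proof.
move=> /rows_beforeP lt_x; rewrite inE => ne_x; apply: contraT => lT.
have := lt_x (leader i); rewrite !inE negb_or ne_x lT => /(_ isT).
have [|_ le_leader] := @first_inP [set: V] i.
  by apply/card_gt0P; exists x; rewrite inE.
by rewrite ltnNge le_leader ?inE.
Qed.

Lemma sum_card_led_rows : \sum_x #|led_rows x| = #|I|.
Proof.
rewrite -sum1_card (partition_big leader predT) //=; apply: eq_bigr => x _.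
by rewrite -sum1_card; apply: eq_bigl => i; rewrite inE.
Qed.

Lemma leq_card_heavy : #|heavy| <= \sum_x excess x.
Proof.
rewrite -sum1_card [leqRHS](bigID (mem heavy)) /=.
by apply: leq_trans (leq_addr _ _); apply: leq_sum => x; rewrite inE.
Qed.

Hypotheses (rk_suitable : suitable_ranking t rk) (def_t : m + #|V| = t.+1).

Lemma card_led_rowsE x : #|led_rows x| = m + excess x.
Proof.
rewrite subnKC //.
have := suitable_ranking_compl rk_suitable def_t (negbT (in_set0 x)).
rewrite cards0 addn0 => /leq_trans; apply; apply/subset_leq_card/subsetP => i.
by move=> /leader_rows_before lead; apply: contraT => /lead; rewrite inE.
Qed.

Lemma sum_excess e : #|I| <= m * #|V| + e -> \sum_x excess x <= e.
Proof.
rewrite -sum_card_led_rows (eq_bigr _ (fun x _ => card_led_rowsE x)).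
by rewrite big_split sum_nat_const mulnC leq_add2l.
Qed.

Lemma card_led_rows_light x : x \in light -> #|led_rows x| = m.
Proof. by rewrite card_led_rowsE !inE -eqn0Ngt => /eqP->; rewrite addn0. Qed.

Definition rows_starting_with (a b : V) : {set I} :=
  led_rows a :&: rows_before rk b (~: [set b; a]).

Definition opening_row (a b : V) : I :=
  odflt i0 [pick i in rows_starting_with a b].

Lemma opening_row_starts_with a b :
  b \in light :\ a -> opening_row a b \in rows_starting_with a b.
Proof.
case/setD1P=> ba bL; rewrite /opening_row; case: pickP => //= no_row.
have [|i iR iL] := @ltn_card_subsetPn _ (rows_before rk b (~: [set b; a]))
    (led_rows b).
  rewrite card_led_rows_light // -addn1 -(cards1 a).
  by apply: suitable_ranking_compl rk_suitable def_t _; rewrite inE.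
have := leader_rows_before iR iL; rewrite inE => lead_i.
by case/negP: (negbT (no_row i)); rewrite in_setI iR andbT inE.
Qed.

Lemma opening_row_led a b :
  b \in light :\ a -> opening_row a b \in led_rows a.
Proof. by case/opening_row_starts_with/setIP. Qed.

Lemma opening_row_before a b x :
    b \in light :\ a -> x != a -> x != b ->
  rk (opening_row a b) b < rk (opening_row a b) x.
Proof.
case/opening_row_starts_with/setIP=> _ /rows_beforeP lt_b xa xb; apply: lt_b.
by rewrite !inE negb_or xb.
Qed.

Lemma opening_row_inj a : {in light :\ a &, injective (opening_row a)}.
Proof.
move=> b b' bL b'L eq_row; apply/eqP; apply: contraT => bb'.
have [[ba _] [b'a _]] := (setD1P bL, setD1P b'L).
have := opening_row_before bL b'a; rewrite eq_sym => /(_ bb') lt_b.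
by have := opening_row_before b'L ba bb'; rewrite -eq_row ltnNge ltnW.
Qed.

Definition spare_rows (a : V) : {set I} :=
  led_rows a :\: opening_row a @: (light :\ a).

Lemma card_spare_rows a : a \in light -> #|spare_rows a| + #|light| = m.+1.
Proof.
move=> aL; have sub : opening_row a @: (light :\ a) \subset led_rows a.
  by apply/subsetP => _ /imsetP[b bL ->]; apply: opening_row_led.
rewrite -(card_led_rows_light aL) (cardsD1 a light) aL add1n addnS.
rewrite -(card_in_imset (@opening_row_inj a)) cardsDS // subnK //.
exact: subset_leq_card.
Qed.

Definition first_heavy (i : I) : V := first_in heavy i.

Definition spare_firsts (a : V) : {set V} := first_heavy @: spare_rows a.

Lemma leq_card_heavyD_spare_firsts a :
  a \in light -> #|V| <= #|heavy :\: spare_firsts a| + m.+1.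
Proof.
move=> aL; have := card_spare_rows aL; have := cardsC heavy; rewrite -/light.
have := leq_imset_card first_heavy (spare_rows a); rewrite -/(spare_firsts a).
have := subset_leq_card (subsetIr heavy (spare_firsts a)); rewrite cardsD.
lia.
Qed.

Lemma spare_firsts_sub_heavy a :
  m.+1 < #|V| -> a \in light -> spare_firsts a \subset heavy.
Proof.
move=> ltmV aL; apply/subsetP => _ /imsetP[i _ ->].
apply: (@proj1 _ _ (first_inP _ _)).
have := leq_card_heavyD_spare_firsts aL.
have := subset_leq_card (subsetDl heavy (spare_firsts a)); lia.
Qed.

Definition avoids (b : V) : rel V := [rel a a' |
  (first_heavy (opening_row a a') != b) &&
  (first_heavy (opening_row a' a) != b)].

Lemma avoids_sym b : symmetric (avoids b).
Proof. by move=> a a'; rewrite /avoids /= andbC. Qed.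

Lemma exists_avoids (D : {set V}) a a' :
  2 < #|D| -> exists2 b, b \in D & avoids b a a'.
Proof.
move=> D2; have [|b bD] := @ltn_card_subsetPn _ D
    [set first_heavy (opening_row a a'); first_heavy (opening_row a' a)].
  by rewrite cards2; case: (_ != _); rewrite // ltnW.
by rewrite !inE negb_or ![b == _]eq_sym => b_avoids; exists b.
Qed.

(* Otherwise some row not led by [b] has [b] before all symbols outside [T]: its
   leader [a] lies in [T] and [b] is its first heavy symbol, so that it is
   neither spare nor the chosen row of any pair of light symbols. *)
Lemma avoids_clique_leq_excess b (T : {set V}) :
    b \in heavy -> T \subset light ->
    {in T, forall a, b \notin spare_firsts a} -> clique (avoids b) T ->
  #|T| <= excess b.
Proof.
move=> bH TL b_spare T_avoids; rewrite leqNgt; apply/negP => ltT.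
have light_notin z : z \in heavy -> z \notin T.
  by move=> zH; apply/negP => /(subsetP TL); rewrite inE zH.
have bT := light_notin b bH.
have [|i iR iL] := @ltn_card_subsetPn _ (rows_before rk b (~: (b |: T)))
    (led_rows b).
  rewrite card_led_rowsE.
  apply: leq_trans (suitable_ranking_compl rk_suitable def_t bT).
  by rewrite -addnS leq_add2l.
have first_b : first_heavy i = b.
  apply: first_in_eq => // z zH zb; have /rows_beforeP := iR; apply.
  by rewrite !inE negb_or zb light_notin.
set a := leader i; have aT : a \in T := leader_rows_before iR iL.
have ia : i \in led_rows a by rewrite inE.
have [/imsetP[s sL def_i]|i_spare] :=
    boolP (i \in opening_row a @: (light :\ a)); last first.
  case/negP: (b_spare a aT); rewrite -first_b; apply: imset_f.
  by rewrite inE i_spare.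
have [sa sL'] := setD1P sL.
have sT : s \notin T.
  apply/negP => sT; have := T_avoids a s aT sT.
  by rewrite eq_sym sa => /(_ isT)/andP[]; rewrite -def_i first_b eqxx.
have bs : b != s by apply: contraTneq sL' => <-; rewrite inE bH.
have ba : b != a by apply: contraNneq bT => ->.
have /rows_beforeP/(_ s) := iR; rewrite !inE negb_or eq_sym bs sT => /(_ isT).
have := opening_row_before sL ba bs; rewrite -def_i => /ltn_trans/[apply].
by rewrite ltnn.
Qed.

Lemma exists_constant_spare_firsts n :
    m.+1 < #|V| -> 2 ^ #|heavy| * n < #|light| ->
  exists X, n < #|[set a in light | spare_firsts a == X]|.
Proof.
move=> ltmV ltn; have [||X _ ltX] := @pigeonhole_bigcup _ _ light
    (powerset heavy) (fun X => [set a in light | spare_firsts a == X]) n;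
  last by exists X.
- apply/subsetP => a aL; apply/bigcupP; exists (spare_firsts a).
    by rewrite inE spare_firsts_sub_heavy.
  by rewrite inE aL eqxx.
- by rewrite card_powerset.
Qed.

Lemma ltn_card_constant_spare_firsts (X : {set V}) :
    m + 4 <= #|V| ->
  #|[set a in light | spare_firsts a == X]| < 3 ^ (\sum_x excess x + 3).
Proof.
move=> lemV; set A := [set a in light | _]; rewrite ltnNge; apply/negP => leA.
have /card_gt0P[a] : 0 < #|A| by apply: leq_trans leA; rewrite expn_gt0.
rewrite inE => /andP[/leq_card_heavyD_spare_firsts leV /eqP def_X].
have [|D sD cD] := @exists_subset_card _ (heavy :\: X) 3.
  by rewrite -def_X; lia.
have [||x y _ _ _||b [T [bD sT cT T_avoids]]] :=
    @multicolor_ramsey _ _ avoids D (fun b => (excess b).+1) A.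
- exact: avoids_sym.
- by rewrite cD.
- by apply/exists_inP/exists_avoids; rewrite cD.
- rewrite cD; apply: leq_trans leA; rewrite leq_exp2l //.
  under eq_bigr do rewrite -addn1.
  rewrite big_split /= sum_nat_const cD muln1 leq_add2r.
  by rewrite [leqRHS](bigID (mem D)) leq_addr.
have /setDP[bH bX] := subsetP sD b bD.
have TA a' : a' \in T -> a' \in light /\ spare_firsts a' = X.
  by move/(subsetP sT); rewrite inE => /andP[? /eqP].
suff: #|T| <= excess b by rewrite cT ltnn.
apply: avoids_clique_leq_excess => //; first by apply/subsetP => a' /TA[].
by move=> a' /TA[_ ->].
Qed.

End HeavySymbols.

Lemma leq_exp2_exp3 k e : k <= e -> 3 ^ (e + 3) * 2 ^ k + k <= 3 ^ (2 * e + 3).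
Proof.
move=> leke; have le3 : 2 ^ k + k <= 3 ^ e.
  apply: (@leq_trans (3 ^ k)); last by rewrite leq_exp2l.
  by elim: (k) => // j; rewrite !expnS; have := ltn_expl j (isT : 1 < 2); lia.
rewrite mul2n -addnn addnAC [3 ^ (_ + e)]expnD.
apply: leq_trans (leq_mul (leqnn _) le3).
by rewrite mulnDr leq_add2l leq_pmull // expn_gt0.
Qed.

Lemma no_suitable_ranking (I V : finType) (rk : I -> V -> nat) t m e :
    m + #|V| = t.+1 -> #|I| <= m * #|V| + e -> m + 4 <= #|V| ->
    3 ^ (2 * e + 3) <= #|V| ->
  ~ suitable_ranking t rk.
Proof.
move=> def_t leI lemV leV rkP.
have /card_gt1P[x0 [y0 [_ _ xy]]] : 1 < #|V| by lia.
have /card_gt0P[i0 _] : 0 < #|I|.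
  have y0_notin : y0 \notin [set x0] by rewrite inE eq_sym.
  have := suitable_ranking_compl rkP def_t y0_notin; rewrite cards1 addn1.
  by move=> /(leq_ltn_trans (leq0n _))/leq_trans; apply; apply: max_card.
have ex_e := sum_excess x0 rkP def_t leI.
have leH := leq_trans (leq_card_heavy rk m x0) ex_e.
have [||X] := @exists_constant_spare_firsts _ _ _ _ _ x0 i0 rkP def_t
    (3 ^ (e + 3)).-1.
- lia.
- have := leq_exp2_exp3 leH; have := cardsC (heavy rk m x0).
  have : 0 < 3 ^ (e + 3) by rewrite expn_gt0.
  have : 0 < 2 ^ #|heavy rk m x0| by rewrite expn_gt0.
  rewrite -/(light rk m x0); nia.
rewrite prednK ?expn_gt0 // leqNgt => /negP; apply.
apply: leq_trans (ltn_card_constant_spare_firsts x0 i0 rkP def_t X lemV) _.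
by rewrite leq_exp2l // leq_add2r.
Qed.

Lemma no_suitable_core N v t w m e :
    t <= N.+1 -> w <= v -> m + w = t.+1 -> N <= m * w + e -> m + 4 <= w ->
    3 ^ (2 * e + 3) <= w ->
  ~ has_suitable_core N v t.
Proof.
move=> leN lewv def_t leNw lemw lew /(has_suitable_core_restrict leN lewv)[rk].
by apply: (@no_suitable_ranking _ _ _ t m e); rewrite !card_ord.
Qed.

Lemma card_rows_before_sub (I V : finType) (J : {set I}) (rk : I -> V -> nat)
    x U :
  #|rows_before (fun i : {i | i \in J} => rk (val i)) x U|
    = #|rows_before rk x U :&: J|.
Proof.
rewrite -(card_imset _ val_inj); apply: eq_card => i; apply/imsetP/setIP.
  by case=> [[j jJ]] lt_x ->; split=> //; move: lt_x; rewrite !inE.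
by case=> lt_x iJ; exists (exist _ i iJ) => //; move: lt_x; rewrite !inE.
Qed.

Section PairRanking.

Variables (v : nat) (z0 z1 : 'I_v).

Let Z : {set 'I_v} := [set z0; z1].

Definition z_first (a b : 'I_v) : 'I_v := if a < b then z0 else z1.

Lemma z_first_mem a b : z_first a b \in Z.
Proof. by rewrite /z_first !inE; case: ifP; rewrite eqxx ?orbT. Qed.

(* The row of [(a, b)] starts with [a], [b]; then come [z0] and [z1], in an
   order that depends on whether [a < b]; the rest of the row is arbitrary. *)
Definition pair_rank (ab : 'I_v * 'I_v) (x : 'I_v) : nat :=
  if x == ab.1 then 0 else if x == ab.2 then 1
  else if x == z_first ab.1 ab.2 then 2 else if x \in Z then 3 else 4.

Definition pair_rows : {set 'I_v * 'I_v} :=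
  [set ab | (ab.2 \notin Z) && (ab.1 != ab.2)].

Lemma card_pair_rows : #|pair_rows| = (v - #|Z|) * v.-1.
Proof.
have -> : #|pair_rows| = \sum_(b in ~: Z) \sum_(a in [set~ b]) 1.
  pose swap (ab : 'I_v * 'I_v) := (ab.2, ab.1).
  rewrite -sum1_card pair_big_dep (reindex swap).
    by apply: eq_bigl => -[b a]; rewrite !inE.
  by exists swap => -[].
under eq_bigr do rewrite sum1_card cardsC1 card_ord.
by rewrite sum_nat_const cardsCs setCK card_ord.
Qed.

Definition pair_rows_before (x : 'I_v) (U : {set 'I_v}) : {set 'I_v * 'I_v} :=
  rows_before pair_rank x U :&: pair_rows.

Lemma pair_rows_before_leading x b (U : {set 'I_v}) :
  x \notin U -> b \notin x |: Z -> (x, b) \in pair_rows_before x U.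
Proof.
move=> xU; rewrite in_setU1 negb_or => /andP[bx bZ].
rewrite in_setI; apply/andP; split; last by rewrite inE /= bZ eq_sym bx.
apply/rows_beforeP => y yU; rewrite /pair_rank /= eqxx ifN.
  by do 3?case: ifP.
by apply: contraNneq xU => <-.
Qed.

Lemma pair_rows_before_second x a (U : {set 'I_v}) :
    x \notin U -> x \notin Z -> a \notin x |: U ->
  (a, x) \in pair_rows_before x U.
Proof.
move=> xU xZ; rewrite in_setU1 negb_or => /andP[ax aU].
rewrite in_setI; apply/andP; split; last by rewrite inE /= xZ ax.
apply/rows_beforeP => y yU.
have [ya yx] : y != a /\ y != x.
  by split; [apply: contraNneq aU | apply: contraNneq xU] => <-.
rewrite /pair_rank /= eqxx eq_sym (negPf ax) (negPf ya) (negPf yx).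
by do 2?case: ifP.
Qed.

Lemma pair_rows_before_third x a b (U : {set 'I_v}) :
    x \notin U -> x \in Z -> a \notin x |: U -> b \notin x |: U ->
    a != b -> b \notin Z -> (a \in Z) || (x == z_first a b) ->
  (a, b) \in pair_rows_before x U.
Proof.
move=> xU xZ; rewrite in_setU1 negb_or => /andP[ax aU].
rewrite in_setU1 negb_or => /andP[bx bU] ab bZ az.
rewrite in_setI; apply/andP; split; last by rewrite inE /= bZ ab.
apply/rows_beforeP => y yU.
have [ya yb yx] : [/\ y != a, y != b & y != x].
  by split; [apply: contraNneq aU | apply: contraNneq bU | apply: contraNneq xU]
    => <-.
rewrite /pair_rank /= ![x == _]eq_sym (negPf ax) (negPf bx).
rewrite (negPf ya) (negPf yb).
move: az; have [<- _|_ /[!orbF] aZ] := eqVneq x (z_first a b).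
  by rewrite (negPf yx); case: ifP.
have xa : x != a by rewrite eq_sym.
have yZ : y \notin Z by rewrite /Z (set2_of_mem xZ aZ xa) !inE negb_or yx.
rewrite xZ (negPf yZ) ifN //; apply: contraNneq yZ => ->.
exact: z_first_mem.
Qed.

Lemma exists_pivot x (T : {set 'I_v}) :
    x \in Z -> x \notin T -> 0 < #|T| ->
  exists2 a, a \in T & {in T :\ a, forall b,
    b \notin Z /\ ((a \in Z) || (x == z_first a b))}.
Proof.
move=> xZ xT /card_gt0P[a0 a0T].
have ne_x b : b \in T -> b != x by move=> bT; apply: contraNneq xT => <-.
(* Take the other element of [Z] if it lies in [T], and an extremal element of
   [T] otherwise. *)
have [/exists_inP[a aT aZ]|/exists_inPn T_Z] := boolP [exists a in T, a \in Z].
  exists a => // b /setD1P[ba bT]; rewrite aZ; split=> //.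
  have xa : x != a by rewrite eq_sym ne_x.
  by rewrite /Z (set2_of_mem xZ aZ xa) !inE negb_or ne_x.
have [/eqP def_x|/eqP def_x] := set2P xZ.
  have [a aT a_min] := arg_minnP (@nat_of_ord v) a0T.
  exists a => // b /setD1P[ba bT]; split; first exact: T_Z.
  rewrite /z_first ifT ?def_x ?eqxx ?orbT //.
  by rewrite ltn_neqAle a_min // andbT eq_sym.
have [a aT a_max] := arg_maxnP (@nat_of_ord v) a0T.
exists a => // b /setD1P[ba bT]; split; first exact: T_Z.
rewrite /z_first ifN ?def_x ?eqxx ?orbT // -leqNgt.
exact: a_max.
Qed.

Lemma leq_card_pair_rows_leading x (U : {set 'I_v}) : x \notin U ->
  v - #|x |: Z| <= #|pair_rows_before x U :&: [set ab | ab.1 == x]|.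
Proof.
move=> xU; pose L := [set (x, b) | b in ~: (x |: Z)].
have <- : #|L| = v - #|x |: Z|.
  by rewrite card_imset => [|? ? []//]; rewrite cardsCs setCK card_ord.
apply/subset_leq_card/subsetP => _ /imsetP[b /setCP/negP bZ ->].
by rewrite in_setI pair_rows_before_leading // inE eqxx.
Qed.

Lemma leq_card_pair_rows_not_leading x (U : {set 'I_v}) : x \notin U ->
  #|~: (x |: U)| <=
    #|pair_rows_before x U :\: [set ab | ab.1 == x]| + (x \in Z).
Proof.
move=> xU; set T := ~: (x |: U).
have T_notin a : a \in T -> a \notin x |: U by rewrite in_setC.
have xT : x \notin T by rewrite !inE eqxx.
have T_neq a : a \in T -> a != x by move=> aT; apply: contraNneq xT => <-.
have [xZ|xZ] := boolP (x \in Z); last first.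
  have <- : #|[set (a, x) | a in T]| = #|T| by rewrite card_imset // => ? ? [].
  rewrite addn0; apply/subset_leq_card/subsetP => _ /imsetP[a aT ->].
  by rewrite in_setD pair_rows_before_second ?T_notin // inE T_neq.
have [->|[a0 a0T]] := set_0Vmem T; first by rewrite cards0.
have [|a aT a_pivot] := @exists_pivot x T xZ xT.
  by apply/card_gt0P; exists a0.
have -> : #|T| = #|[set (a, b) | b in T :\ a]| + 1.
  by rewrite card_imset => [|? ? []//]; rewrite (cardsD1 a T) aT addnC.
rewrite leq_add2r; apply/subset_leq_card/subsetP => _ /imsetP[b bTa ->].
have [[bZ az] [ba bT]] := (a_pivot b bTa, setD1P bTa).
rewrite eq_sym in ba.
by rewrite in_setD pair_rows_before_third ?T_notin // inE T_neq.
Qed.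

Lemma pair_rank_suitable : #|Z| < v ->
  suitable_ranking (2 * v - 2 - #|Z|)
    (fun ab : {ab | ab \in pair_rows} => pair_rank (val ab)).
Proof.
move=> ltZ x U xU; rewrite card_rows_before_sub -/(pair_rows_before x U).
rewrite -(cardsID [set ab | ab.1 == x] (pair_rows_before x U)).
have := leq_card_pair_rows_leading xU.
have := leq_card_pair_rows_not_leading xU.
have := cardsC (x |: U); rewrite (cardsU1 x U) (cardsU1 x Z) xU card_ord.
case: (x \in Z) ltZ => /=;
  by move: #|Z| #|U| #|~: _| #|_ :&: _| #|_ :\: _|; lia.
Qed.

Lemma has_suitable_core_pairs N :
    #|Z| < v -> (v - #|Z|) * v.-1 <= N -> 2 * v - 2 - #|Z| <= N.+1 ->
  has_suitable_core N v (2 * v - 2 - #|Z|).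
Proof.
move=> ltZ leI leN.
apply: has_suitable_core_of_ranking (pair_rank_suitable ltZ) => //.
by rewrite card_sig -card_pair_rows in leI *.
Qed.

End PairRanking.

(* [k] is the size of [Z]: 1 for odd and 2 for even strength. *)
Lemma is_SCN_pairs k s l : 0 < k <= 2 -> 1 < s -> 3 ^ (2 * l + 15) <= s ->
  is_SCN (2 * s + 2 - k) ((s + 2 - k) * (s + 1) + l) (s + 2).
Proof.
move=> k12 s1 les; split; first by lia.
- have [z0 [z1 def_k]] : exists z0 z1 : 'I_(s + 2), #|[set z0; z1]| = k.
    have lt0 : 0 < s + 2 by lia.
    have ltk : k.-1 < s + 2 by lia.
    exists (Ordinal lt0), (Ordinal ltk).
    by rewrite cards2; case: k k12 ltk => [|[|[|]]].
  have := @has_suitable_core_pairs _ z0 z1 ((s + 2 - k) * (s + 1) + l).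
  rewrite def_k (_ : 2 * (s + 2) - 2 - k = 2 * s + 2 - k); last by lia.
  by apply; [lia | nia | nia].
- move=> v' _ coreC; rewrite leqNgt; apply/negP => lt_v'.
  apply: (@no_suitable_core _ _ _ (s + 3) (s - k) (l + 2 * k + 2))
    coreC.
  + by nia.
  + by lia.
  + by lia.
  + by nia.
  + by lia.
  + apply: leq_trans (leq_trans _ les) (leq_addr _ _).
    by rewrite leq_exp2l //; lia.
Qed.

Lemma leq_expn_of_ln (R : realType) (b c l s : nat) :
    1 < b -> 0 < c -> 0 < s ->
    (l%:R <= ln (s%:R : R) / (c%:R * ln (b%:R : R)))%R ->
  b ^ (c * l) <= s.
Proof.
move=> b1 c0 s0; have lnb : (0 < ln (b%:R : R))%R by rewrite ln_gt0 // ltr1n.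
rewrite ler_pdivlMr ?mulr_gt0 ?ltr0n // => le_ln.
have b0 := ltnW b1; rewrite -(ler_nat R) -ler_ln ?posrE ?ltr0n ?expn_gt0 ?b0 //.
rewrite natrX lnXn ?ltr0n //.
by rewrite -[(_ *+ (c * l))%R]mulr_natl natrM -mulrA mulrCA.
Qed.

Lemma leq_expnD b j k s :
  b ^ (2 * j) <= s -> b ^ (2 * k) <= s -> b ^ (j + k) <= s.
Proof.
move=> lej lek; rewrite -leq_sqr -expnM mulnC mulnDr expnD expnS expn1.
exact: leq_mul.
Qed.

Lemma is_SCN_eventually (R : realType) (l : nat -> nat) :
    (forall s : nat, 0 < s ->
      ((l s)%:R <= ln (s%:R : R) / (6 * ln (3 : R)))%R) ->
  exists s0 : nat, forall k s : nat, 0 < k <= 2 -> s0 <= s ->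
    is_SCN (2 * s + 2 - k) ((s + 2 - k) * (s + 1) + l s) (s + 2).
Proof.
move=> le_l; exists (maxn 2 (3 ^ (2 * 15))) => k s k12.
rewrite geq_max => /andP[s1 le_s]; apply: is_SCN_pairs => //.
apply: leq_expnD => //; apply: leq_trans (_ : 3 ^ (6 * l s) <= s).
  by rewrite leq_exp2l //; lia.
by apply: leq_expn_of_ln (le_l s _) => //; apply: ltnW.
Qed.

Theorem theorem4 (R : realType) :
  (forall l : nat -> nat,
    (forall s : nat, 0 < s ->
      ((l s)%:R <= ln (s%:R : R) / (6 * ln (3 : R)))%R) ->
    exists s0 : nat, forall s : nat, s0 <= s ->
      is_SCN (2 * s + 1) ((s + 1) ^ 2 + l s) (s + 2)) /\
  (forall l : nat -> nat,
    (forall s : nat, 0 < s ->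
      ((l s)%:R <= ln (s%:R : R) / (6 * ln (3 : R)))%R) ->
    exists s0 : nat, forall s : nat, s0 <= s ->
      is_SCN (2 * s) (s * (s + 1) + l s) (s + 2)).
Proof.
split=> l /is_SCN_eventually[s0 scn_s]; exists s0 => s le_s.
- have -> : 2 * s + 1 = 2 * s + 2 - 1 by lia.
  have -> : (s + 1) ^ 2 = (s + 2 - 1) * (s + 1) by nia.
  exact: scn_s.
- by have := scn_s 2 s isT le_s; rewrite !addnK.
Qed.
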